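(* Let $G$ be a finite group (of unitaries in $\mathcal{U}_d$) forming an $n$-design on $\mathbb{C}^d$, and let $\rho_n$ be an $S_n$-invariant quantum state on $(\mathbb{C}^d)^{\otimes n}$, i.e. $P_\pi\rho_nP_\pi^\dagger=\rho_n$ for all $\pi\in S_n$; with respect to the Schur-Weyl decomposition write $\rho_n=\bigoplus_{\lambda}\rho_\lambda\otimes\mathbb{I}_{\mathcal{W}_\lambda}$ with positive operators $\rho_\lambda$ on $\mathcal{V}_\lambda^d$. Let $\rho_g=g^{\otimes n}\rho_n(g^{\otimes n})^\dagger$ form a geometrically uniform ensemble $(\rho_g)_{g\in G}$ (with uniform prior probabilities $\frac{1}{|G|}$). Then the optimal success probability of state discrimination is $$p_{\mathrm{succ}}^*=\frac{1}{|G|}\sum_{\lambda}d_\lambda\,m_{d,\lambda}\,\lambda_{\max}(\rho_\lambda).$$ An optimal choice of POVM is given by $$M_g=g^{\otimes n}\Big(\bigoplus_{\lambda}\frac{d_\lambda}{d_\lambda^{\max}}\,\Pi^{\max}_{\rho_\lambda}\otimes\mathbb{I}_{\mathcal{W}_\lambda}\Big)(g^\dagger)^{\otimes n},$$ where $\Pi^{\max}_{\rho_\lambda}$ is the projector onto the eigenspace of $\rho_\lambda$ corresponding to its largest eigenvalue and $d_\lambda^{\max}$ is the dimension of this maximal eigenspace.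
   Context: $\mathcal{U}_d$ is the unitary group on $\mathbb{C}^d$. A finite subset $X\subset\mathcal{U}_d$ is a $k$-design if $\frac{1}{|X|}\sum_{V\in X}V^{\otimes k}F(V^\dagger)^{\otimes k}=\int_{\mathcal{U}_d}U^{\otimes k}F(U^\dagger)^{\otimes k}\,dU$ for all linear operators $F$ on $(\mathbb{C}^d)^{\otimes k}$, with $dU$ the normalized Haar measure. For $\pi\in S_n$, $P_\pi(v_1\otimes\cdots\otimes v_n)=v_{\pi^{-1}(1)}\otimes\cdots\otimes v_{\pi^{-1}(n)}$. Schur-Weyl decomposition: $(\mathbb{C}^d)^{\otimes n}\cong\bigoplus_{\lambda\vdash_d n}\mathcal{V}_\lambda^d\otimes\mathcal{W}_\lambda$, where $\lambda\vdash_d n$ ranges over partitions of $n$ into at most $d$ parts (all sums over $\lambda$ are over this set), $\mathcal{V}_\lambda^d$ is an irreducible representation of $\mathcal{U}_d$ of dimension $m_{d,\lambda}$, $\mathcal{W}_\lambda$ is an irreducible representation of $S_n$ of dimension $d_\lambda$, and $P_\pi\cong\bigoplus_\lambda\mathbb{I}_{\mathcal{V}_\lambda^d}\otimes p_\lambda(\pi)$, $U^{\otimes n}\cong\bigoplus_\lambda q_\lambda(U)\otimes\mathbb{I}_{\mathcal{W}_\lambda}$ with $p_\lambda,q_\lambda$ the corresponding irreps. $\lambda_{\max}(\cdot)$ denotes the largest eigenvalue. A quantum state is a positive semidefinite operator of unit trace. A POVM is a family $(M_g)_{g\in G}$ of positive semidefinite operators with $\sum_gM_g=\mathbb{I}$;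 the optimal success probability $p_{\mathrm{succ}}^*$ is the maximum of $\frac{1}{|G|}\sum_{g\in G}\operatorname{tr}(M_g\rho_g)$ over all POVMs, and a POVM attaining it is optimal.
   Formalization: The POVM's block coefficient d_λ/d_λ^max is replaced by m_{d,λ}/(|G| d_λ^max): with the printed coefficient the M_g sum to ⊕(|G|d_λ/m_{d,λ})·I, which is not I in general (n=1, d=2, the 16-element Pauli group gives 8·I). *)

(* Defs.v *)
From HB Require Import structures.
From mathcomp Require Import all_boot all_order all_fingroup all_algebra.
From mathcomp Require Import finmap.
From mathcomp.real_closed Require Import complex mxtens.
From mathcomp Require Import all_classical all_reals all_analysis.

Set Implicit Arguments.
Unset Strict Implicit.
Unset Printing Implicit Defensive.

Import Order.TTheory GRing.Theory Num.Theory numFieldNormedType.Exports.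
Local Open Scope classical_set_scope.
Local Open Scope ring_scope.
Local Open Scope sesquilinear_scope.

(* Matrices act on column vectors; [A ^t*] is the adjoint of [A].  The order on
   [R[i]] is the partial order of a [numClosedFieldType]: [x <= y] means that
   [y - x] is a nonnegative real. *)

Record unitary (R : realType) (d : nat) := Unitary {
  unitary_mx :> 'M[R[i]]_d;
  unitary_mxP : unitary_mx \is unitarymx
}.

HB.instance Definition _ (R : realType) d :=
  [isSub for @unitary_mx R d].
HB.instance Definition _ (R : realType) d :=
  [Choice of unitary R d by <:].

Section UnitaryGroup.
Variables (R : realType) (d : nat).
Implicit Types U V W : unitary R d.

Lemma unitary1_subproof : (1%:M : 'M[R[i]]_d) \is unitarymx.
Proof. by apply/unitarymxP; rewrite mul1mx trmx1 map_mx1. Qed.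

Definition unitary_one : unitary R d := Unitary unitary1_subproof.

Definition unitary_mul U V : unitary R d :=
  Unitary (mul_unitarymx (unitary_mxP U) (unitary_mxP V)).

Lemma unitary_inv_subproof U : U^t* \is unitarymx.
Proof. by rewrite trmxC_unitary (unitary_mxP U). Qed.

Definition unitary_inv U : unitary R d :=
  Unitary (unitary_inv_subproof U).

Lemma unitary_mulA : associative unitary_mul.
Proof. by move=> U V W; apply/val_inj; rewrite /= mulmxA. Qed.

Lemma unitary_mul1g : left_id unitary_one unitary_mul.
Proof. by move=> U; apply/val_inj; rewrite /= mul1mx. Qed.

Lemma unitary_mulg1 : right_id unitary_one unitary_mul.
Proof. by move=> U; apply/val_inj; rewrite /= mulmx1. Qed.

Lemma unitary_mulgV : right_inverse unitary_one unitary_inv unitary_mul.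
Proof. by move=> U; apply/val_inj => /=; apply/unitarymxP/(unitary_mxP U). Qed.

Lemma unitary_mulVg : left_inverse unitary_one unitary_inv unitary_mul.
Proof.
move=> U; apply/val_inj => /=.
by apply: mulmx1C; apply/unitarymxP/(unitary_mxP U).
Qed.

HB.instance Definition _ := isGroup.Build (unitary R d)
  unitary_mulA unitary_mul1g unitary_mulg1 unitary_mulVg unitary_mulgV.

HB.instance Definition _ := isPointed.Build (unitary R d) unitary_one.

(* Subspace topology; the topology of the modulus is attached to [R[i]^o]. *)
HB.instance Definition _ := Topological.copy (unitary R d)
  (initial_topology (@unitary_mx R d : unitary R d -> 'M[R[i]^o]_d)).

End UnitaryGroup.

Definition unitary_borel (R : realType) (d : nat) :=
  g_sigma_algebraType (@open (unitary R d)).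

Definition is_haar (R : realType) (d : nat)
    (mu : probability (unitary_borel R d) R) : Prop :=
  forall (V : unitary R d) (A : set (unitary_borel R d)), measurable A ->
    mu [set (V * U)%g | U in A] = mu A.

(* Entrywise integral of a matrix-valued function. *)
Definition mx_integral (R : realType) d (T : measurableType d)
    (mu : {measure set T -> \bar R}) (p q : nat) (f : T -> 'M[R[i]]_(p, q)) :
    'M[R[i]]_(p, q) :=
  \matrix_(i, j) Complex (Rintegral mu setT (fun x => complex.Re (f x i j)))
                         (Rintegral mu setT (fun x => complex.Im (f x i j))).

(* [(C^d)^{(x) n}] has the basis [e_a = e_{a 0} (x) ... (x) e_{a (n-1)}] indexed
   by the finite functions [a : 'I_n -> 'I_d], numbered by [enum_val]. *)
Definition tdim (d n : nat) : nat := #|{ffun 'I_n -> 'I_d}|.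

Definition tens_family (R : realType) (n p q : nat)
    (A : 'I_n -> 'M[R[i]]_(p, q)) : 'M[R[i]]_(tdim p n, tdim q n) :=
  \matrix_(a, b) \prod_(k < n)
     A k ((enum_val a : {ffun 'I_n -> 'I_p}) k)
         ((enum_val b : {ffun 'I_n -> 'I_q}) k).

Definition tens_pow (R : realType) (d n : nat) (A : 'M[R[i]]_d) :
    'M[R[i]]_(tdim d n) :=
  tens_family (fun _ : 'I_n => A).

Definition perm_op (R : realType) (d n : nat) (s : 'S_n) :
    'M[R[i]]_(tdim d n) :=
  \matrix_(a, b) ((enum_val a : {ffun 'I_n -> 'I_d}) ==
    [ffun k => (enum_val b : {ffun 'I_n -> 'I_d}) ((s^-1)%g k)])%:R.

Lemma perm_op_tens (R : realType) (d n : nat) (s : 'S_n)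
    (v : 'I_n -> 'cV[R[i]]_d) :
  perm_op R d s *m tens_family v = tens_family (fun k => v ((s^-1)%g k)).
Proof.
apply/matrixP => a c; rewrite !mxE.
pose b0 : {ffun 'I_n -> 'I_d} :=
  [ffun k => (enum_val a : {ffun 'I_n -> 'I_d}) (s k)].
rewrite (bigD1 (enum_rank b0)) //= big1 => [|b neqb]; last first.
  rewrite !mxE; case: eqP => [Ea|_]; last by rewrite mul0r.
  case/eqP: neqb; apply: enum_val_inj; rewrite enum_rankK.
  by apply/ffunP => k; rewrite ffunE Ea ffunE permK.
rewrite addr0 !mxE enum_rankK; case: eqP => [_|]; last first.
  by case; apply/ffunP => k; rewrite !ffunE permKV.
rewrite mul1r (reindex_perm (s^-1)%g) /=; apply: eq_bigr => k _.
by rewrite ffunE permKV; congr (v _ _ _); rewrite [LHS]ord1 [RHS]ord1.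
Qed.

Definition is_design (R : realType) (d : nat)
    (mu : probability (unitary_borel R d) R) (k : nat)
    (X : {fset unitary R d}) : Prop :=
  forall F : 'M[R[i]]_(tdim d k),
    (#|` X|%:R)^-1 *: \sum_(V : X)
       tens_pow k (val V) *m F *m (tens_pow k (val V))^t* =
    mx_integral mu (fun U : unitary_borel R d =>
       tens_pow k (U : unitary R d) *m F *m (tens_pow k (U : unitary R d))^t*).

(* Partitions of [n] into at most [d] parts, padded with zeros to length [d]. *)
Definition is_partition (d n : nat) (l : {ffun 'I_d -> 'I_n.+1}) : bool :=
  [forall i : 'I_d, forall j : 'I_d, (i <= j)%N ==> (l j <= l i)%N] &&
  (\sum_(i < d) l i == n)%N.

Definition partition_le (d n : nat) :=
  {l : {ffun 'I_d -> 'I_n.+1} | is_partition l}.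

HB.instance Definition _ d n := Finite.on (partition_le d n).

Section Representations.
Variables (R : realType) (T : Type).

(* Matrix representation on columns of the group [T] with unit [one] and law
   [mul]. *)
Definition is_repr (one : T) (mul : T -> T -> T) (m : nat)
    (f : T -> 'M[R[i]]_m) : Prop :=
  f one = 1%:M /\ forall x y, f (mul x y) = f x *m f y.

(* Subspaces are column spans of matrices [W]; [(A^T <= W^T)%MS] says that the
   columns of [A] lie in the column span of [W]. *)
Definition is_irreducible (m : nat) (f : T -> 'M[R[i]]_m) : Prop :=
  (0 < m)%N /\
  forall W : 'M[R[i]]_m, (forall x, ((f x *m W)^T <= W^T)%MS) ->
    \rank W = 0%N \/ \rank W = m.

Definition is_equivalent (m m' : nat) (f : T -> 'M[R[i]]_m)
    (f' : T -> 'M[R[i]]_m') : Prop :=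
  exists (A : 'M[R[i]]_(m', m)) (B : 'M[R[i]]_(m, m')),
    [/\ A *m B = 1%:M, B *m A = 1%:M & forall x, A *m f x = f' x *m A].

End Representations.

Arguments is_repr {R T} one mul {m} f.

(* A unitary isomorphism of [H] with the orthogonal sum of the spaces [K_l] is
   given by its restrictions [J l : K_l -> H]; [dsum J X] is the operator on [H]
   corresponding to the block-diagonal operator with blocks [X l]. *)
Definition dsum (R : realType) (I : finType) (D : nat) (k : I -> nat)
    (J : forall l, 'M[R[i]]_(D, k l)) (X : forall l, 'M[R[i]]_(k l)) :
    'M[R[i]]_D :=
  \sum_(l : I) J l *m X l *m (J l)^t*.

(* A Schur-Weyl decomposition of [(C^d)^{(x) n}].  As the product [(s * t)%g] of
   permutations is the composite "[s], then [t]", [sw_p] is a representation for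
   the opposite product. *)
Record schur_weyl (R : realType) (d n : nat) := SchurWeyl {
  sw_m : partition_le d n -> nat;
  sw_d : partition_le d n -> nat;
  sw_q : forall l, unitary R d -> 'M[R[i]]_(sw_m l);
  sw_p : forall l, 'S_n -> 'M[R[i]]_(sw_d l);
  sw_iso : forall l, 'M[R[i]]_(tdim d n, sw_m l * sw_d l);
  sw_q_repr : forall l, is_repr 1%g (fun U V => (U * V)%g) (sw_q l);
  sw_q_irr : forall l, is_irreducible (sw_q l);
  sw_q_neq : forall l l', is_equivalent (sw_q l) (sw_q l') -> l = l';
  sw_p_repr : forall l, is_repr 1%g (fun s t => (t * s)%g) (sw_p l);
  sw_p_irr : forall l, is_irreducible (sw_p l);
  sw_p_neq : forall l l', is_equivalent (sw_p l) (sw_p l') -> l = l';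
  sw_iso_isometry : forall l, (sw_iso l)^t* *m sw_iso l = 1%:M;
  sw_iso_orthogonal : forall l l', l != l' -> (sw_iso l)^t* *m sw_iso l' = 0;
  sw_iso_complete : \sum_l sw_iso l *m (sw_iso l)^t* = 1%:M;
  sw_perm : forall s,
    perm_op R d s = dsum sw_iso (fun l => 1%:M *t sw_p l s);
  sw_unitary : forall U : unitary R d,
    tens_pow n U = dsum sw_iso (fun l => sw_q l U *t 1%:M)
}.

Section States.
Variable R : realType.
Implicit Types D : nat.

Definition is_psd D (A : 'M[R[i]]_D) : Prop :=
  forall v : 'cV[R[i]]_D, 0 <= (v^t* *m A *m v) 0 0.

Definition is_state D (A : 'M[R[i]]_D) : Prop := is_psd A /\ \tr A = 1.

Definition is_povm (I : finType) D (M : I -> 'M[R[i]]_D) : Prop :=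
  (forall g, is_psd (M g)) /\ \sum_g M g = 1%:M.

Definition maximum (A : set R[i]) : R[i] := xget 0 (A `&` ubound A).

Definition success (I : finType) D (rho M : I -> 'M[R[i]]_D) : R[i] :=
  (#|I|%:R)^-1 * \sum_g \tr (M g *m rho g).

Definition p_succ_opt (I : finType) D (rho : I -> 'M[R[i]]_D) : R[i] :=
  maximum [set success rho M | M in [set M | is_povm M]].

Definition is_optimal_povm (I : finType) D (rho M : I -> 'M[R[i]]_D) : Prop :=
  is_povm M /\ forall N, is_povm N -> success rho N <= success rho M.

Definition lambda_max D (A : 'M[R[i]]_D) : R[i] :=
  maximum [set a | eigenvalue A a].

(* [eigenspace] is a space of row vectors, whence the transposes: the rows of
   [max_eigenspace A] are the transposes of the column eigenvectors. *)
Definition max_eigenspace D (A : 'M[R[i]]_D) : 'M[R[i]]_D :=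
  eigenspace A^T (lambda_max A).

Definition max_proj D (A : 'M[R[i]]_D) : 'M[R[i]]_D :=
  (proj_ortho (max_eigenspace A))^T.

Definition max_dim D (A : 'M[R[i]]_D) : nat := \rank (max_eigenspace A).

End States.

(* [rho = (+)_l r l (x) 1] with all [r l] positive. *)
Definition sw_decomposes (R : realType) (d n : nat) (SW : schur_weyl R d n)
    (rho : 'M[R[i]]_(tdim d n)) (r : forall l, 'M[R[i]]_(sw_m SW l)) : Prop :=
  (forall l, is_psd (r l)) /\
  rho = dsum (sw_iso SW) (fun l => r l *t (1%:M : 'M[R[i]]_(sw_d SW l))).

Definition gu_ensemble (R : realType) (d n : nat) (G : {fset unitary R d})
    (rho : 'M[R[i]]_(tdim d n)) (g : G) : 'M[R[i]]_(tdim d n) :=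
  tens_pow n (val g) *m rho *m (tens_pow n (val g))^t*.

(* The block coefficient [m_l / (|G| d_l^max)] is the one for which
   [\sum_(g in G) M_g = 1] when [G] is an [n]-design. *)
Definition opt_povm (R : realType) (d n : nat) (SW : schur_weyl R d n)
    (G : {fset unitary R d}) (r : forall l, 'M[R[i]]_(sw_m SW l)) (g : G) :
    'M[R[i]]_(tdim d n) :=
  tens_pow n (val g) *m
  dsum (sw_iso SW) (fun l =>
    ((sw_m SW l)%:R / (#|` G|%:R * (max_dim (r l))%:R)) *:
    (max_proj (r l) *t (1%:M : 'M[R[i]]_(sw_d SW l)))) *m
  tens_pow n ((val g : unitary R d)^t*).

(* Main.v *)
Require Import Defs.
From mathcomp Require Import all_boot all_order all_fingroup all_algebra.
From mathcomp Require Import finmap.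
From mathcomp.real_closed Require Import complex mxtens.
From mathcomp Require Import all_classical all_reals all_analysis.
From mathcomp Require Import measurable_realfun ring.

(* Writing U = g^{(x) n}, one has U rho U^* <= K for the block operator
   K = (+)_l lambda_max(r_l) 1, because K commutes with U; hence any POVM
   satisfies sum_g tr (N_g rho_g) <= tr K.  The candidate POVM reaches tr K as
   r_l Pi_l = lambda_max(r_l) Pi_l.  That it sums to the identity is where the
   design enters: the average over G of U X U^* is the Haar twirl of X, which
   commutes with every V^{(x) n}, so that by Schur's lemma its blocks are
   scalars, determined by their traces.  The block form of rho is Schur's lemma
   for the irreducible representations of the symmetric group. *)

Set Implicit Arguments.
Unset Strict Implicit.
Unset Printing Implicit Defensive.

Import Order.TTheory GRing.Theory Num.Theory.
Local Open Scope ring_scope.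
Local Open Scope sesquilinear_scope.

(** * Positive semidefinite matrices *)

Section Adjoint.
Variable C : numClosedFieldType.

Lemma adjmxM m n p (A : 'M[C]_(m, n)) (B : 'M[C]_(n, p)) :
  (A *m B)^t* = B^t* *m A^t*.
Proof. by rewrite trmx_mul map_mxM. Qed.

Lemma adjmxD m n (A B : 'M[C]_(m, n)) : (A + B)^t* = A^t* + B^t*.
Proof. by rewrite linearD /= map_mxD. Qed.

Lemma adjmxZ m n a (A : 'M[C]_(m, n)) : (a *: A)^t* = a^* *: A^t*.
Proof. by rewrite linearZ /= map_mxZ. Qed.

Lemma adjmx_scalar n (a : C) : (a%:M : 'M[C]_n)^t* = (a^*)%:M.
Proof. by rewrite tr_scalar_mx map_scalar_mx. Qed.

Lemma adjmx_tens m n p q (A : 'M[C]_(m, n)) (B : 'M[C]_(p, q)) :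
  (A *t B)^t* = A^t* *t B^t*.
Proof. by rewrite trmx_tens map_mxT. Qed.

Lemma adjmx_mul_diag m n (A : 'M[C]_(m, n)) j :
  (A^t* *m A) j j = \sum_i `|A i j| ^+ 2.
Proof.
by rewrite mxE; apply: eq_bigr => i _; rewrite !mxE normCK mulrC.
Qed.

Lemma quadratic_form_eq0 n (B : 'M[C]_n) :
  (forall v : 'cV[C]_n, (v^t* *m B *m v) 0 0 = 0) -> B = 0.
Proof.
move=> B0.
have pol (u v : 'cV[C]_n) : (u^t* *m B *m v) 0 0 = 0.
  (* Polarization: q is used at x = 1 and x = 'i. *)
  have q (x : C) : x * (u^t* *m B *m v) 0 0 + x^* * (v^t* *m B *m u) 0 0 = 0.
    have := B0 (u + x *: v).
    rewrite adjmxD adjmxZ !mulmxDl !mulmxDr -!(scalemxAl, scalemxAr).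
    have addE (M N : 'M[C]_1) : (M + N) 0 0 = M 0 0 + N 0 0 by rewrite mxE.
    have sclE (a : C) (M : 'M[C]_1) : (a *: M) 0 0 = a * M 0 0 by rewrite mxE.
    by rewrite !addE !sclE !B0 !mulr0 add0r addr0.
  have q1 := q 1; have qi := q 'i.
  move: q1 qi; rewrite conjCi rmorph1 !mul1r mulNr -mulrBr => q1 /eqP.
  rewrite mulf_eq0 (negPf (neq0Ci C)) /= subr_eq0 => /eqP q2.
  move: q1; rewrite -q2 -mulr2n => /eqP.
  by rewrite mulrn_eq0 /= => /eqP.
apply/matrixP => i j; rewrite [RHS]mxE -(pol (delta_mx i 0) (delta_mx j 0)).
rewrite trmx_delta map_delta_mx -mulmxA -colE -rowE !mxE //.
Qed.

(** The factors of the rank factorization of an idempotent multiply in the reverse order to the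
    identity of size [\rank P], and the trace is cyclic. *)
Lemma trace_idempotent n (P : 'M[C]_n) : P *m P = P -> \tr P = (\rank P)%:R.
Proof.
move=> PP.
have RC : row_base P *m col_base P = 1%:M.
  have := PP; rewrite -{1 2 3}(mulmx_base P) -mulmxA.
  move/(row_full_inj (col_base_full P)); rewrite mulmxA.
  by move=> e; apply: (row_free_inj (row_base_free P)); rewrite e mul1mx.
by rewrite -{1}(mulmx_base P) mxtrace_mulC RC mxtrace1.
Qed.

(** The rows of [1 - P] are orthogonal to those of [P], so [P^t* = P *m P^t*], whose right-hand side
    is self-adjoint. *)
Lemma proj_ortho_adj m n (U : 'M[C]_(m, n)) : (proj_ortho U)^t* = proj_ortho U.
Proof.
set P := proj_ortho U.
have PPa : P^t* = P *m P^t*.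
  apply/eqP; rewrite -subr_eq0 -{1}(mul1mx (P^t*)) -mulmxBl; apply/eqP.
  apply/orthomx1P; rewrite (eqmx_ortho _ (proj_orthoE U)).
  by have := proj_ortho_compl_sub U 1%:M; rewrite mul1mx.
by rewrite [LHS]PPa -[RHS]trmxCK [in RHS]PPa (adjmxM P) trmxCK.
Qed.

End Adjoint.

Section Psd.
Variable R : realType.
Local Notation C := R[i].

(** Nonnegative values are real, so the quadratic form of [A^t* - A] vanishes everywhere. This opens
    the way to the spectral theorem for normal matrices. *)
Lemma psd_adj n (A : 'M[C]_n) : is_psd A -> A^t* = A.
Proof.
move=> A_psd; apply/eqP; rewrite -subr_eq0; apply/eqP.
apply: quadratic_form_eq0 => v; have /ger0_real/CrealP vAv := A_psd v.
have subE (M N : 'M[C]_1) : (M - N) 0 0 = M 0 0 - N 0 0 by rewrite !mxE.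
have adjE (M : 'M[C]_1) : (M^t*) 0 0 = (M 0 0)^* by rewrite !mxE.
rewrite mulmxBr mulmxBl subE -[v^t* *m A^t* *m v]trmxCK.
by rewrite adjE !adjmxM !trmxCK mulmxA vAv subrr.
Qed.

Lemma gram_psd m n (Y : 'M[C]_(m, n)) : is_psd (Y^t* *m Y).
Proof.
move=> v; rewrite mulmxA -adjmxM -mulmxA adjmx_mul_diag.
by apply: sumr_ge0 => i _; rewrite exprn_ge0.
Qed.

Lemma psd_conj m n (B : 'M[C]_(m, n)) (A : 'M[C]_m) :
  is_psd A -> is_psd (B^t* *m A *m B).
Proof.
by move=> A_psd v; have := A_psd (B *m v); rewrite adjmxM !mulmxA.
Qed.

Lemma psd_sum n (I : finType) (A : I -> 'M[C]_n) :
  (forall i, is_psd (A i)) -> is_psd (\sum_i A i).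
Proof.
move=> A_psd v; rewrite mulmx_sumr mulmx_suml summxE.
by apply: sumr_ge0 => i _; apply: A_psd.
Qed.

Lemma psd_scale n (a : C) (A : 'M[C]_n) :
  0 <= a -> is_psd A -> is_psd (a *: A).
Proof.
by move=> a0 A_psd v; rewrite -scalemxAr -scalemxAl mxE mulr_ge0.
Qed.

Lemma psd_spectralE n (A : 'M[C]_n) : is_psd A ->
  A = (spectralmx A)^t* *m diag_mx (spectral_diag A) *m spectralmx A.
Proof.
move=> /psd_adj A_adj.
have /orthomx_spectralP : A \is normalmx by apply/normalmxP; rewrite A_adj.
by rewrite invmx_unitary ?spectral_unitarymx.
Qed.

Lemma spectral_diagE n (A : 'M[C]_n) : is_psd A ->
  spectralmx A *m A = diag_mx (spectral_diag A) *m spectralmx A.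
Proof.
move=> A_psd; rewrite {2}(psd_spectralE A_psd) !mulmxA.
by have /unitarymxP -> := spectral_unitarymx A; rewrite mul1mx.
Qed.

Lemma spectral_diag_ge0 n (A : 'M[C]_n) : is_psd A ->
  forall i, 0 <= spectral_diag A 0 i.
Proof.
move=> A_psd i.
have := psd_conj ((spectralmx A)^t*) A_psd (delta_mx i 0).
rewrite trmxCK spectral_diagE // -(mulmxA (diag_mx _)).
have /unitarymxP -> := spectral_unitarymx A; rewrite mulmx1.
by rewrite trmx_delta map_delta_mx -mulmxA -colE -rowE !mxE eqxx.
Qed.

(** Take the square root of the spectrum in the eigenbasis. Positivity questions thereby reduce to
    Gram matrices. *)
Lemma psd_factor n (A : 'M[C]_n) : is_psd A ->
  exists Y : 'M[C]_n, A = Y^t* *m Y.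
Proof.
move=> A_psd.
exists (diag_mx (\row_i sqrtC (spectral_diag A 0 i)) *m spectralmx A).
rewrite adjmxM mulmxA -(mulmxA _ _ (diag_mx _)) tr_diag_mx map_diag_mx.
rewrite mulmx_diag.
rewrite {1}(psd_spectralE A_psd); congr (_ *m diag_mx _ *m _).
apply/rowP => i; rewrite !mxE [X in _ = X * _]conj_Creal -?expr2 ?sqrtCK //.
by rewrite ger0_real // sqrtC_ge0 spectral_diag_ge0.
Qed.

Lemma psd_tens m n (A : 'M[C]_m) (B : 'M[C]_n) :
  is_psd A -> is_psd B -> is_psd (A *t B).
Proof.
move=> /psd_factor[Y ->] /psd_factor[Z ->].
by rewrite -tensmx_mul -adjmx_tens; apply: gram_psd.
Qed.

Lemma psd_1 n : is_psd (1%:M : 'M[C]_n).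
Proof.
by have := gram_psd (1%:M : 'M[C]_n); rewrite adjmx_scalar rmorph1 mulmx1.
Qed.

(** By cyclicity the trace is that of [Y *m A *m Y^t*], again a Gram matrix, with sums of squared
    moduli on the diagonal. *)
Lemma psd_trace_mul n (A B : 'M[C]_n) :
  is_psd A -> is_psd B -> 0 <= \tr (A *m B).
Proof.
move=> A_psd /psd_factor[Y ->]; rewrite mulmxA mxtrace_mulC mulmxA.
have /(psd_conj (Y^t*))/psd_factor[Z] := A_psd.
rewrite trmxCK => ->.
apply: sumr_ge0 => i _; rewrite adjmx_mul_diag.
by apply: sumr_ge0 => j _; rewrite exprn_ge0.
Qed.

Lemma psd_diag n (D : 'rV[C]_n) : (forall i, 0 <= D 0 i) -> is_psd (diag_mx D).
Proof.
move=> D_ge0 v; rewrite mul_mx_diag mxE; apply: sumr_ge0 => i _.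
by rewrite !mxE mulrAC mulr_ge0 // mulrC mul_conjC_ge0.
Qed.

(** * Largest eigenvalue and its eigenspace *)

Lemma maximum_eq (A : set C) (x : C) :
  A x -> (forall y, A y -> y <= x) -> maximum A = x.
Proof.
move=> Ax Ale; apply: xget_subset1; first by split.
by move=> y z [Ay yub] [Az zub]; apply/le_anti; rewrite zub //= yub.
Qed.

(** In eigenbasis coordinates [w] the equation is diagonal, and any nonzero coordinate singles out
    an entry equal to [a]. *)
Lemma eigenvalue_spectral n (A : 'M[C]_n) a : is_psd A ->
  eigenvalue A a -> exists i, a = spectral_diag A 0 i.
Proof.
move=> A_psd /eigenvalueP[v vA v0].
pose w := v *m (spectralmx A)^t*.
have Su := spectral_unitarymx A.
have SaS : (spectralmx A)^t* *m spectralmx A = 1%:M.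
  by apply: mulmx1C; apply/unitarymxP.
have vE : v = w *m spectralmx A by rewrite -mulmxA SaS mulmx1.
have /rV0Pn[k wk] : w != 0 by apply: contraNneq v0 => w0; rewrite vE w0 mul0mx.
have wD : w *m diag_mx (spectral_diag A) = a *: w.
  have /(congr1 (mulmx^~ ((spectralmx A)^t*))) := vA.
  rewrite /= {1}vE -(mulmxA w) spectral_diagE // -!mulmxA.
  by move/unitarymxP: Su => ->; rewrite mulmx1 scalemxAl.
exists k; move/rowP/(_ k): wD; rewrite mul_mx_diag mxE [in RHS]mxE mulrC => e.
exact: (mulIf wk (esym e)).
Qed.

(** [lambda_max] is a choice with default 0; this certifies that a largest eigenvalue exists and is
    the one chosen. *)
Lemma lambda_max_spec n (A : 'M[C]_n) : (0 < n)%N -> is_psd A ->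
  eigenvalue A (lambda_max A) /\ is_psd ((lambda_max A)%:M - A).
Proof.
move=> n0 A_psd; pose i0 : 'I_n := Ordinal n0.
have D_ge0 := spectral_diag_ge0 A_psd.
(* The order on [R[i]] is partial; a maximizing index exists because the spectral entries are
   real. *)
case: (@real_arg_maxP _ _ i0 xpredT (spectral_diag A 0)) => // [j _|i _ imax].
  exact: ger0_real.
have Su := spectral_unitarymx A.
have eig_i : eigenvalue A (spectral_diag A 0 i).
  apply/eigenvalueP; exists (row i (spectralmx A)).
    by rewrite -row_mul spectral_diagE // row_mul row_diag_mx -scalemxAl -rowE.
  apply: contraTneq (oner_neq0 C) => Si0.
  have /unitarymxP/(congr1 (row i)) := Su.
  rewrite row_mul Si0 mul0mx => /rowP/(_ i); rewrite !mxE eqxx => e.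
  by rewrite negbK; apply/eqP/esym.
have -> : lambda_max A = spectral_diag A 0 i.
  apply: maximum_eq => // a /(eigenvalue_spectral A_psd)[j ->].
  exact: imax.
split=> //.
(* In the eigenbasis the difference is diagonal, its entries being the gaps to the largest
   eigenvalue. *)
have -> : (spectral_diag A 0 i)%:M - A = (spectralmx A)^t* *m
    diag_mx (\row_j (spectral_diag A 0 i - spectral_diag A 0 j)) *m
    spectralmx A.
  have -> : \row_j (spectral_diag A 0 i - spectral_diag A 0 j) =
     const_mx (spectral_diag A 0 i) - spectral_diag A.
    by apply/rowP => j; rewrite !mxE.
  rewrite linearB /= diag_const_mx mulmxBr mulmxBl -(psd_spectralE A_psd).
  rewrite mul_mx_scalar -scalemxAl; congr (_ - _).
  have -> : (spectralmx A)^t* *m spectralmx A = 1%:M.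
    by apply: mulmx1C; apply/unitarymxP.
  by rewrite scalemx1.
by apply/psd_conj/psd_diag => j; rewrite mxE subr_ge0; apply: imax.
Qed.

(** The transpose of an orthogonal projection is still self-adjoint and idempotent, hence its own
    Gram matrix. *)
Lemma max_proj_psd n (A : 'M[C]_n) : is_psd (max_proj A).
Proof.
rewrite /max_proj; set P := proj_ortho _.
have <- : (P^T)^t* *m P^T = P^T; last exact: gram_psd.
have -> : (P^T)^t* = (P^t*)^T by rewrite map_trmx.
by rewrite proj_ortho_adj -trmx_mul proj_ortho_proj.
Qed.

Lemma trace_max_proj n (A : 'M[C]_n) : \tr (max_proj A) = (max_dim A)%:R.
Proof.
rewrite /max_proj mxtrace_tr trace_idempotent ?proj_ortho_proj //.
by rewrite /max_dim (proj_orthoE (max_eigenspace A)).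
Qed.

Lemma mulmx_max_proj n (A : 'M[C]_n) :
  A *m max_proj A = lambda_max A *: max_proj A.
Proof.
rewrite /max_proj -{1}(trmxK A) -trmx_mul -linearZ /=; congr _^T.
by apply/eigenspaceP; rewrite proj_orthoE.
Qed.

(** [max_eigenspace A] is an eigenspace of [A^T], which has the same characteristic polynomial as
    [A]. Used to cancel [max_dim] in the measurement. *)
Lemma max_dim_gt0 n (A : 'M[C]_n) : (0 < n)%N -> is_psd A -> (0 < max_dim A)%N.
Proof.
move=> n0 /(lambda_max_spec n0)[/eigenvalueP[v vA v0] _].
rewrite /max_dim lt0n mxrank_eq0.
have : eigenvalue A^T (lambda_max A); last by [].
have charT : char_poly A^T = char_poly A.
  rewrite /char_poly -[RHS]det_tr; congr (\det _).
  by rewrite /char_poly_mx linearB /= tr_scalar_mx map_trmx.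
rewrite eigenvalue_root_char charT -eigenvalue_root_char.
by apply/eigenvalueP; exists v.
Qed.

End Psd.

(** * Schur's lemma and tensor products *)

Section Schur.
Variables (R : realType) (T : Type).
Local Notation C := R[i].

(** Kernel and image of an intertwiner are invariant. The transposes pass between the column spans
    of [is_irreducible] and the row spaces of the library. *)
Lemma schur m m' (f : T -> 'M[C]_m) (f' : T -> 'M[C]_m') (X : 'M[C]_(m', m)) :
  is_irreducible f -> is_irreducible f' ->
  (forall x, X *m f x = f' x *m X) -> X != 0 ->
  exists B : 'M[C]_(m, m'), X *m B = 1%:M /\ B *m X = 1%:M.
Proof.
move=> [_ f_irr] [_ f'_irr] Xf X0.
have XfT x : (f x)^T *m X^T = X^T *m (f' x)^T by rewrite -!trmx_mul Xf.
have rX0 : \rank X != 0%N by rewrite mxrank_eq0.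
have rX : \rank X = m.
  (* The columns of this matrix span the kernel of [X], which is not everything as [X] is
     nonzero. *)
  have [x||] := f_irr (kermx X^T)^T.
  - rewrite trmx_mul trmxK; apply/sub_kermxP.
    by rewrite -mulmxA XfT mulmxA mulmx_ker mul0mx.
  - rewrite mxrank_tr mxrank_ker mxrank_tr => /eqP; rewrite subn_eq0 => le_m.
    by apply/eqP; rewrite eqn_leq rank_leq_col.
  - rewrite mxrank_tr mxrank_ker mxrank_tr => e; case/negP: rX0.
    by rewrite -(subKn (rank_leq_col X)) e subnn.
have rX' : \rank X = m'.
  (* The image of [X], given by a square matrix as [is_irreducible] requires. *)
  have [x||] := f'_irr (<<X^T>>%MS)^T.
  - rewrite trmx_mul trmxK genmxE.
    by rewrite (eqmxMr _ (genmxE _)) -XfT submxMl.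
  - by rewrite mxrank_tr genmxE mxrank_tr => /eqP; rewrite (negPf rX0).
  - by rewrite mxrank_tr genmxE mxrank_tr.
exists (pinvmx X); split; first by apply: mulmxVp; rewrite /row_free rX'.
by apply: mulVpmx; rewrite /row_full rX.
Qed.

(** For an eigenvalue [a] the intertwiner [X - a%:M] annihilates an eigenvector; not being
    invertible, it is zero. *)
Lemma schur_scalar m (f : T -> 'M[C]_m) (X : 'M[C]_m) :
  is_irreducible f -> (forall x, X *m f x = f x *m X) -> exists a, X = a%:M.
Proof.
move=> f_irr Xf.
have [a /eigenvalueP[v vX v0]] := eigenvalue_closed X (proj1 f_irr).
exists a; apply/eqP; rewrite -subr_eq0; apply: contraNT v0 => Xa0.
have [|B [XB _]] := schur f_irr f_irr _ Xa0.
  by move=> x; rewrite mulmxBl mulmxBr Xf scalar_mxC.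
by rewrite -(mulmx1 v) -XB mulmxA mulmxBr vX mul_mx_scalar subrr mul0mx.
Qed.

End Schur.

(** * Tensor products as block matrices *)

Section TensorBlock.
Variable K : comNzRingType.

(** The indices [i], [j] belong to the first factors, and the block is an operator between the
    second ones. Intertwining relations for [1%:M *t p s] thus hold block by block. *)
Definition tens_block m n m' n' (Y : 'M[K]_(m * n, m' * n')) i j :
    'M[K]_(n, n') :=
  \matrix_(k, l) Y (mxtens_index (i, k)) (mxtens_index (j, l)).

Lemma sum_mxtens m n (F : 'I_(m * n) -> K) :
  \sum_k F k = \sum_i \sum_j F (mxtens_index (i, j)).
Proof.
rewrite pair_big (reindex (@mxtens_index m n)) /=; last first.
  exists (@mxtens_unindex m n) => i _; last exact: mxtens_unindexK.
  exact: mxtens_indexK.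
by apply: eq_bigr => -[].
Qed.

Lemma tens_block_eqP m n m' n' (Y Z : 'M[K]_(m * n, m' * n')) :
  (forall i j, tens_block Y i j = tens_block Z i j) -> Y = Z.
Proof.
move=> YZ; apply/matrixP => a b.
case: (mxtens_indexP a) => i k; case: (mxtens_indexP b) => j l.
by have /matrixP/(_ k l) := YZ i j; rewrite !mxE.
Qed.

Lemma tens_block_tens m n m' n' (A : 'M[K]_(m, m')) (B : 'M[K]_(n, n')) i j :
  tens_block (A *t B) i j = A i j *: B.
Proof. by apply/matrixP => k l; rewrite mxE tensmxE [RHS]mxE. Qed.

Lemma tens_block_mulr m n m' n' p (Y : 'M[K]_(m * n, m' * n'))
    (Z : 'M[K]_(n', p)) i j :
  tens_block (Y *m ((1%:M : 'M[K]_m') *t Z)) i j = tens_block Y i j *m Z.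
Proof.
apply/matrixP => k l; rewrite mxE mxE [RHS]mxE sum_mxtens.
rewrite (bigD1 j) //= [X in _ + X]big1 ?addr0.
  by apply: eq_bigr => s _; rewrite tensmxE !mxE eqxx mul1r.
move=> j' /negPf jj'; apply: big1 => s _.
by rewrite tensmxE mxE jj' mul0r mulr0.
Qed.

Lemma tens_block_mull m n m' n' p (Y : 'M[K]_(m * n, m' * n'))
    (Z : 'M[K]_(p, n)) i j :
  tens_block (((1%:M : 'M[K]_m) *t Z) *m Y) i j = Z *m tens_block Y i j.
Proof.
apply/matrixP => k l; rewrite mxE mxE [RHS]mxE sum_mxtens.
rewrite (bigD1 i) //= [X in _ + X]big1 ?addr0.
  by apply: eq_bigr => s _; rewrite tensmxE !mxE eqxx mul1r.
move=> i' /negPf ii'; apply: big1 => s _.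
by rewrite tensmxE mxE eq_sym ii' !mul0r.
Qed.

Lemma tensmx1_inj m n (A B : 'M[K]_m) : (0 < n)%N ->
  A *t (1%:M : 'M[K]_n) = B *t 1%:M -> A = B.
Proof.
move=> n0 AB; apply/matrixP => i j; pose k := Ordinal n0.
have /matrixP/(_ (mxtens_index (i, k)) (mxtens_index (j, k))) := AB.
by rewrite !tensmxE mxE eqxx !mulr1.
Qed.

Lemma tensmx11 m n : (1%:M : 'M[K]_m) *t (1%:M : 'M[K]_n) = 1%:M.
Proof.
apply: tens_block_eqP => i j; rewrite tens_block_tens.
apply/matrixP => k l; rewrite !mxE (can_eq (@mxtens_indexK m n)) xpair_eqE.
by case: eqP => _; rewrite ?mul1r ?mul0r.
Qed.

Lemma tensmxZl m n m' n' a (A : 'M[K]_(m, m')) (B : 'M[K]_(n, n')) :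
  (a *: A) *t B = a *: (A *t B).
Proof. by apply/matrixP => i j; rewrite !mxE mulrA. Qed.

Lemma tensmxBl m n m' n' (A A' : 'M[K]_(m, m')) (B : 'M[K]_(n, n')) :
  (A - A') *t B = A *t B - A' *t B.
Proof. by apply/matrixP => i j; rewrite !mxE mulrBl. Qed.

Lemma tensmx_suml (I : finType) m n m' n' (A : I -> 'M[K]_(m, m'))
    (B : 'M[K]_(n, n')) :
  (\sum_i A i) *t B = \sum_i A i *t B.
Proof.
apply/matrixP => i j; rewrite !mxE !summxE mulr_suml.
by apply: eq_bigr => k _; rewrite mxE.
Qed.

Lemma mxtrace_tens m n (A : 'M[K]_m) (B : 'M[K]_n) :
  \tr (A *t B) = \tr A * \tr B.
Proof.
rewrite /mxtrace sum_mxtens mulr_suml; apply: eq_bigr => i _.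
by rewrite mulr_sumr; apply: eq_bigr => j _; rewrite tensmxE.
Qed.

End TensorBlock.

Section TensorPositive.
Variables (R : realType) (T : Type).
Local Notation C := R[i].

(** Test the tensor product on [v] times a basis vector. *)
Lemma psd_tens1_inv m n (A : 'M[C]_m) : (0 < n)%N ->
  is_psd (A *t (1%:M : 'M[C]_n)) -> is_psd A.
Proof.
move=> n0 A_psd v; pose e : 'cV[C]_n := delta_mx (Ordinal n0) 0.
have := psd_conj (v *t e) A_psd 1%:M.
rewrite adjmx_tens !tensmx_mul adjmx_scalar rmorph1 mul1mx mulmx1.
rewrite mulmx1 trmx_delta map_delta_mx mul_delta_mx.
by rewrite mxE [X in _ * X]mxE !ord1 mulr1.
Qed.

(** Each block intertwines [p'] and [p], so by Schur's lemma a nonzero block would be an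
    equivalence. *)
Lemma intertwiner_tens_eq0 m n m' n' (p : T -> 'M[C]_n) (p' : T -> 'M[C]_n')
    (Y : 'M[C]_(m * n, m' * n')) :
  is_irreducible p -> is_irreducible p' -> ~ is_equivalent p' p ->
  (forall s, Y *m (1%:M *t p' s) = (1%:M *t p s) *m Y) -> Y = 0.
Proof.
move=> p_irr p'_irr neq_p Yp; apply: tens_block_eqP => i j.
have -> : tens_block (0 : 'M[C]_(m * n, m' * n')) i j = 0.
  by apply/matrixP => k l; rewrite !mxE.
apply/eqP; apply: contrapT => /negP Y0; apply: neq_p.
have Yijp s : tens_block Y i j *m p' s = p s *m tens_block Y i j.
  by rewrite -tens_block_mulr Yp tens_block_mull.
have [B [YB BY]] := schur p'_irr p_irr Yijp Y0.
by exists (tens_block Y i j), B.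
Qed.

(** Each block commutes with [p] and is therefore a scalar; these scalars are the entries of [r]. *)
Lemma commutant_tens m n (p : T -> 'M[C]_n) (Y : 'M[C]_(m * n)) :
  is_irreducible p ->
  (forall s, Y *m (1%:M *t p s) = (1%:M *t p s) *m Y) ->
  exists r : 'M[C]_m, Y = r *t 1%:M.
Proof.
move=> p_irr Yp.
have scal i j : exists a, tens_block Y i j = a%:M.
  apply: (schur_scalar p_irr) => s.
  by rewrite -tens_block_mulr Yp tens_block_mull.
(* The default 0 is never reached, since [scal] supplies a scalar for every block. *)
exists (\matrix_(i, j) xget 0 [set a | tens_block Y i j = a%:M]%classic).
apply: tens_block_eqP => i j; rewrite tens_block_tens mxE scalemx1.
by case: xgetP => [a _ //|]; have [a Ya] := scal i j; move/(_ a).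
Qed.

End TensorPositive.

(** * Block-diagonal operators on an orthogonal sum *)

Section Dsum.
Variables (R : realType) (I : finType) (D : nat) (k : I -> nat).
Local Notation C := R[i].
Variable J : forall l, 'M[C]_(D, k l).
Hypothesis J_isometry : forall l, (J l)^t* *m J l = 1%:M.
Hypothesis J_orthogonal : forall l l', l != l' -> (J l)^t* *m J l' = 0.
Hypothesis J_complete : \sum_l J l *m (J l)^t* = 1%:M.
Implicit Types X Y : forall l, 'M[C]_(k l).

Lemma mul_dsum_iso X l : dsum J X *m J l = J l *m X l.
Proof.
rewrite mulmx_suml (bigD1 l) //= big1 ?addr0 => [|l' neq_l].
  by rewrite -!mulmxA J_isometry mulmx1.
by rewrite -mulmxA J_orthogonal // mulmx0.
Qed.

Lemma mul_adjiso_dsum X l : (J l)^t* *m dsum J X = X l *m (J l)^t*.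
Proof.
rewrite mulmx_sumr (bigD1 l) //= big1 ?addr0 => [|l' neq_l].
  by rewrite !mulmxA J_isometry mul1mx.
by rewrite !mulmxA J_orthogonal 1?eq_sym // !mul0mx.
Qed.

Lemma dsum_block X l : (J l)^t* *m dsum J X *m J l = X l.
Proof. by rewrite mul_adjiso_dsum -mulmxA J_isometry mulmx1. Qed.

Lemma dsumM X Y : dsum J X *m dsum J Y = dsum J (fun l => X l *m Y l).
Proof.
rewrite {2}/dsum mulmx_sumr; apply: eq_bigr => l _.
by rewrite !mulmxA mul_dsum_iso.
Qed.

Lemma dsum_adj X : (dsum J X)^t* = dsum J (fun l => (X l)^t*).
Proof.
rewrite /dsum linear_sum /= rmorph_sum /=; apply: eq_bigr => l _.
by rewrite !adjmxM trmxCK mulmxA.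
Qed.

Lemma eq_dsum X Y : (forall l, X l = Y l) -> dsum J X = dsum J Y.
Proof. by move=> XY; apply: eq_bigr => l _; rewrite XY. Qed.

Lemma dsum1 : dsum J (fun=> 1%:M) = 1%:M.
Proof. by rewrite -[RHS]J_complete; apply: eq_bigr => l _; rewrite mulmx1. Qed.

Lemma dsumB X Y : dsum J X - dsum J Y = dsum J (fun l => X l - Y l).
Proof.
by rewrite /dsum -sumrB; apply: eq_bigr => l _; rewrite mulmxBr mulmxBl.
Qed.

Lemma dsum_sum (K : finType) (X : K -> forall l, 'M[C]_(k l)) :
  \sum_i dsum J (X i) = dsum J (fun l => \sum_i X i l).
Proof.
rewrite exchange_big; apply: eq_bigr => l _ /=.
by rewrite mulmx_sumr mulmx_suml.
Qed.

Lemma dsumZ a X : a *: dsum J X = dsum J (fun l => a *: X l).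
Proof.
by rewrite scaler_sumr; apply: eq_bigr => l _; rewrite -scalemxAr scalemxAl.
Qed.

Lemma dsum_psd X : (forall l, is_psd (X l)) -> is_psd (dsum J X).
Proof.
move=> X_psd; apply: psd_sum => l; rewrite -{1}[J l]trmxCK.
exact: psd_conj.
Qed.

Lemma mxtrace_dsum X : \tr (dsum J X) = \sum_l \tr (X l).
Proof.
rewrite raddf_sum /=; apply: eq_bigr => l _.
by rewrite mxtrace_mulC mulmxA J_isometry mul1mx.
Qed.

(** Inserting [J_complete] on both sides expands [Y] into all its blocks, of which only the diagonal
    ones survive. *)
Lemma dsum_of_blocks (Y : 'M[C]_D) :
  (forall l l', l != l' -> (J l)^t* *m Y *m J l' = 0) ->
  Y = dsum J (fun l => (J l)^t* *m Y *m J l).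
Proof.
move=> Y0; rewrite -{1}(mul1mx Y) -J_complete mulmx_suml; apply: eq_bigr => l _.
rewrite -{1}[Y]mulmx1 -J_complete !mulmx_sumr (bigD1 l) //= big1 ?addr0.
  by rewrite !mulmxA.
move=> l' neq_l; have := Y0 l l'; rewrite eq_sym => /(_ neq_l) e.
rewrite -!mulmxA (mulmxA Y) (mulmxA ((J l)^t*) (Y *m J l')).
by rewrite (mulmxA ((J l)^t*) Y) e mul0mx mulmx0.
Qed.

End Dsum.

(** * Tensor powers and permutation operators *)

Section TensPow.
Variables (R : realType) (d n : nat).
Local Notation C := R[i].
Implicit Types A B : 'M[C]_d.

Lemma tens_pow_mul A B : tens_pow n (A *m B) = tens_pow n A *m tens_pow n B.
Proof.
apply/matrixP => a c; rewrite !mxE.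
under eq_bigr do rewrite mxE.
(* A product over [k] of sums over [j] expands into a sum over functions from [k] to [j], which are
   exactly the basis indices. *)
rewrite (bigA_distr_bigA (fun k j =>
  A ((enum_val a : {ffun 'I_n -> 'I_d}) k) j *
  B j ((enum_val c : {ffun 'I_n -> 'I_d}) k))) /=.
rewrite (reindex (@enum_val {ffun 'I_n -> 'I_d} xpredT)) /=; last first.
  exact/onW_bij/enum_val_bij.
by apply: eq_bigr => b _; rewrite !mxE -big_split.
Qed.

Lemma tens_pow_adj A : tens_pow n (A^t*) = (tens_pow n A)^t*.
Proof.
apply/matrixP => a b; rewrite !mxE rmorph_prod.
by apply: eq_bigr => k _; rewrite !mxE.
Qed.

Lemma tens_pow1 : tens_pow n (1%:M : 'M[C]_d) = 1%:M.
Proof.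
apply/matrixP => a b; rewrite !mxE; case: (eqVneq a b) => [->|neq_ab].
  by apply: big1 => k _; rewrite mxE eqxx.
have [k /negPf neq_k] : exists k, (enum_val a : {ffun 'I_n -> 'I_d}) k
    != (enum_val b : {ffun 'I_n -> 'I_d}) k.
  apply/existsP; apply: contraNT neq_ab; rewrite negb_exists => /forallP eq_ab.
  apply/eqP/enum_val_inj/ffunP => k; apply/eqP; rewrite -[_ == _]negbK.
  exact: eq_ab.
by rewrite (bigD1 k) //= mxE neq_k mul0r.
Qed.

Lemma tens_pow_unitary (U : unitary R d) :
  tens_pow n U *m (tens_pow n U)^t* = 1%:M.
Proof.
by rewrite -tens_pow_adj -tens_pow_mul (unitarymxP (unitary_mxP U)) tens_pow1.
Qed.

Lemma tens_pow_unitaryV (U : unitary R d) :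
  (tens_pow n U)^t* *m tens_pow n U = 1%:M.
Proof. exact/mulmx1C/tens_pow_unitary. Qed.

(** Column [b] has its only nonzero entry in the row of the permuted index [b0]. *)
Lemma perm_op_isometry (s : 'S_n) :
  (perm_op R d s)^t* *m perm_op R d s = 1%:M.
Proof.
apply/matrixP => b c; rewrite !mxE.
pose b0 : {ffun 'I_n -> 'I_d} :=
  [ffun k => (enum_val b : {ffun 'I_n -> 'I_d}) ((s^-1)%g k)].
rewrite (bigD1 (enum_rank b0)) //= [X in _ + X]big1 ?addr0 => [|a neq_a].
  rewrite !mxE enum_rankK eqxx rmorph1 mul1r; congr (_%:R); congr nat_of_bool.
  apply/eqP/eqP => [/ffunP e|bc]; last by rewrite /b0 bc.
  apply/enum_val_inj/ffunP => k.
  by have := e (s k); rewrite !ffunE permK.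
rewrite !mxE; case: eqP => [e|_]; last by rewrite rmorph0 mul0r.
by case/eqP: neq_a; rewrite -[a]enum_valK e.
Qed.

End TensPow.

(** * Haar twirling *)

Section ComplexIntegral.
Local Open Scope classical_set_scope.
Context {dT : measure_display} {T : measurableType dT} {R : realType}.
Variable mu : probability T R.
Local Notation C := R[i].
Local Notation Re := complex.Re.
Local Notation Im := complex.Im.

(** A class that is integrable for a probability measure and closed under sums, products and
    conjugation, hence containing every polynomial in the entries of [U] and their conjugates. *)
Definition bounded_measurable (h : T -> C) :=
  [/\ measurable_fun setT (fun x => Re (h x)),
      measurable_fun setT (fun x => Im (h x)) &
      exists M : R, forall x, `|Re (h x)| <= M /\ `|Im (h x)| <= M].

Lemma bounded_measurable_cst c : bounded_measurable (fun=> c).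
Proof.
split=> //.
by exists (Num.max `|Re c| `|Im c|) => _; rewrite !le_max !lexx orbT.
Qed.

Lemma ReD (x y : C) : Re (x + y) = Re x + Re y.
Proof. by case: x y => ? ? []. Qed.

Lemma ImD (x y : C) : Im (x + y) = Im x + Im y.
Proof. by case: x y => ? ? []. Qed.

Lemma ReM (x y : C) : Re (x * y) = Re x * Re y - Im x * Im y.
Proof. by case: x y => ? ? []. Qed.

Lemma ImM (x y : C) : Im (x * y) = Re x * Im y + Im x * Re y.
Proof. by case: x y => ? ? []. Qed.

Lemma bounded_measurableD h h' :
  bounded_measurable h -> bounded_measurable h' ->
  bounded_measurable (fun x => h x + h' x).
Proof.
move=> [mR mI [M hM]] [mR' mI' [M' hM']]; split.
- by under eq_fun do rewrite ReD; exact: measurable_funD.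
- by under eq_fun do rewrite ImD; exact: measurable_funD.
exists (M + M') => x; have [? ?] := hM x; have [? ?] := hM' x.
rewrite ReD ImD; split; apply: le_trans (ler_normD _ _) _; exact: lerD.
Qed.

Lemma bounded_measurableM h h' :
  bounded_measurable h -> bounded_measurable h' ->
  bounded_measurable (fun x => h x * h' x).
Proof.
move=> [mR mI [M hM]] [mR' mI' [M' hM']]; split.
- under eq_fun do rewrite ReM.
  by apply: measurable_funB; exact: measurable_funM.
- under eq_fun do rewrite ImM.
  by apply: measurable_funD; exact: measurable_funM.
exists (M * M' + M * M') => x; have [? ?] := hM x; have [? ?] := hM' x.
rewrite ReM ImM; split.
  by apply: le_trans (ler_normB _ _) _; rewrite !normrM lerD // ler_pM.
by apply: le_trans (ler_normD _ _) _; rewrite !normrM lerD // ler_pM.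
Qed.

Lemma bounded_measurable_conj h :
  bounded_measurable h -> bounded_measurable (fun x => (h x)^*).
Proof.
have ReC (z : C) : Re z^* = Re z by case: z.
have ImC (z : C) : Im z^* = - Im z by case: z.
move=> [mR mI [M hM]]; split.
- by under eq_fun do rewrite ReC.
- by under eq_fun do rewrite ImC; exact: measurable_funN.
by exists M => x; rewrite ReC ImC normrN.
Qed.

Lemma bounded_measurable_sum (I : finType) (h : I -> T -> C) :
  (forall i, bounded_measurable (h i)) ->
  bounded_measurable (fun x => \sum_i h i x).
Proof.
move=> mh; elim: (index_enum I) => [|i s IHs].
  by under eq_fun do rewrite big_nil; exact: bounded_measurable_cst.
by under eq_fun do rewrite big_cons; exact: bounded_measurableD.
Qed.

Lemma bounded_measurable_prod (I : finType) (h : I -> T -> C) :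
  (forall i, bounded_measurable (h i)) ->
  bounded_measurable (fun x => \prod_i h i x).
Proof.
move=> mh; elim: (index_enum I) => [|i s IHs].
  by under eq_fun do rewrite big_nil; exact: bounded_measurable_cst.
by under eq_fun do rewrite big_cons; exact: bounded_measurableM.
Qed.

Definition cintegral (h : T -> C) : C :=
  Complex (Rintegral mu setT (fun x => Re (h x)))
          (Rintegral mu setT (fun x => Im (h x))).

Lemma bounded_integrable (f : T -> R) M : measurable_fun setT f ->
  (forall x, `|f x| <= M) -> mu.-integrable setT (EFin \o f).
Proof.
move=> mf fM; apply: measurable_bounded_integrable => //.
  exact: le_lt_trans (probability_le1 mu measurableT) (ltry _).
exists M; split; first exact: num_real.
by move=> y My x _; exact: le_trans (fM x) (ltW My).
Qed.

Lemma bounded_measurable_integrable h : bounded_measurable h ->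
  mu.-integrable setT (EFin \o (fun x => Re (h x))) /\
  mu.-integrable setT (EFin \o (fun x => Im (h x))).
Proof.
by move=> [mR mI [M hM]]; split; apply: (@bounded_integrable _ M) => // x;
  have [] := hM x.
Qed.

Lemma cintegralD h h' : bounded_measurable h -> bounded_measurable h' ->
  cintegral (fun x => h x + h' x) = cintegral h + cintegral h'.
Proof.
move=> /bounded_measurable_integrable[iR iI].
move=> /bounded_measurable_integrable[iR' iI'].
rewrite /cintegral.
under eq_Rintegral do rewrite ReD.
under [X in Complex _ X]eq_Rintegral do rewrite ImD.
by rewrite !RintegralD.
Qed.

Lemma cintegralZ c h : bounded_measurable h ->
  cintegral (fun x => c * h x) = c * cintegral h.
Proof.
move=> /bounded_measurable_integrable[iR iI].
have iZ (r : R) f : mu.-integrable setT (EFin \o f) ->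
    mu.-integrable setT (EFin \o (fun x => r * f x)).
  by move=> fi; have := integrableZl measurableT r fi.
rewrite /cintegral.
under eq_Rintegral do rewrite ReM.
under [X in Complex _ X]eq_Rintegral do rewrite ImM.
rewrite RintegralB ?RintegralD ?RintegralZl //; try exact: iZ.
by case: c.
Qed.

Lemma cintegral_sum (I : finType) (h : I -> T -> C) :
  (forall i, bounded_measurable (h i)) ->
  cintegral (fun x => \sum_i h i x) = \sum_i cintegral (h i).
Proof.
move=> mh.
(* Measurability is carried through the induction, as additivity needs it for the partial sums. *)
suff [_] : bounded_measurable (fun x => \sum_i h i x) /\
  cintegral (fun x => \sum_i h i x) = \sum_i cintegral (h i) by [].
elim: (index_enum I) => [|i s [mIH IH]].
  under eq_fun do rewrite big_nil; split; first exact: bounded_measurable_cst.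
  by rewrite big_nil /cintegral !Rintegral_cst // !mul0r.
under eq_fun do rewrite big_cons; split; first exact: bounded_measurableD.
by rewrite big_cons -IH cintegralD.
Qed.

End ComplexIntegral.

(** * Invariance of the Haar twirl *)

Section Haar.
Import numFieldNormedType.Exports.
Local Open Scope classical_set_scope.
Variables (R : realType) (d : nat).
Local Notation C := R[i].
Local Notation Re := complex.Re.
Local Notation Im := complex.Im.
Local Notation UB := (unitary_borel R d).

Lemma unitary_mx_continuous :
  continuous (@unitary_mx R d : unitary R d -> 'M[R[i]^o]_d).
Proof. exact: initial_continuous. Qed.

Lemma Re_continuous : continuous (@complex.Re R : R[i]^o -> R).
Proof.
move=> x A /nbhs_ballP[e /= e0 eA].
(* Radii of balls in [R[i]^o] are themselves elements of [R[i]]. *)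
apply/nbhs_ballP; exists e%:C%C; first by rewrite /= ltcR.
move=> y; rewrite -ball_normE /= => xy; apply: eA; rewrite -ball_normE /=.
rewrite -ltcR; apply: le_lt_trans xy.
have -> : Re x - Re y = Re (x - y) by case: (x) (y) => ? ? [].
exact: normc_ge_Re.
Qed.

Lemma mulcr_continuous (a : C) :
  continuous (fun x : R[i]^o => (x * a : R[i]^o)).
Proof. exact: (@mulrr_continuous R[i] a). Qed.

Lemma continuous_borel_measurable (f : unitary R d -> R) :
  continuous f -> measurable_fun setT (f : UB -> R).
Proof.
move=> /continuousP cf; apply: (measurability _ (RGenOpens.measurableE R)).
move=> _ [_ [a [b ->] <-]]; rewrite setTI.
by apply: sub_sigma_algebra; apply: cf; exact: interval_open.
Qed.

(** Entries are continuous, and bounded by 1 since the columns of a unitary are unit vectors. Both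
    components come from real parts of [U i j * a], with [a = 1] and, up to sign, [a = 'i]. *)
Lemma entry_bounded_measurable i j :
  bounded_measurable (fun U : UB => (U : unitary R d) i j).
Proof.
have cR (a : C) : continuous (fun U : unitary R d => Re (U i j * a)).
  pose m := @unitary_mx R d : unitary R d -> 'M[R[i]^o]_d.
  pose e := (fun M : 'M[R[i]^o]_d => M i j) : _ -> R[i]^o.
  pose r := (fun x => x * a) : R[i]^o -> R[i]^o.
  have cm : continuous m := unitary_mx_continuous.
  have ce : continuous e by exact: (@coord_continuous R[i]).
  have cr : continuous r by exact: mulcr_continuous.
  have cRe : continuous (@complex.Re R : R[i]^o -> R) := Re_continuous.
  suff : continuous ((@complex.Re R : R[i]^o -> R) \o r \o e \o m) by [].
  move=> U.
  have c1 : {for U, continuous (e \o m)} := continuous_comp (cm U) (ce (m U)).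
  have c2 : {for U, continuous (r \o (e \o m))} := continuous_comp c1 (cr _).
  exact: (continuous_comp c2 (cRe _)).
have ImE (x : C) : Im x = - Re (x * 'i%C) by rewrite ReiNIm opprK.
split.
- apply: continuous_borel_measurable.
  by under eq_fun do rewrite -[unitary_mx _ _ _]mulr1; exact: cR.
- under eq_fun do rewrite ImE.
  by apply: measurable_funN; exact: continuous_borel_measurable.
exists 1 => U.
have le1 : `|(U : unitary R d) i j| <= 1.
  rewrite -(@expr_le1 _ 2) //.
  have <- : ((U : unitary R d)^t* *m (U : unitary R d)) j j = 1.
    by rewrite (mulmx1C (unitarymxP (unitary_mxP U))) mxE eqxx.
  rewrite adjmx_mul_diag (bigD1 i) //= lerDl.
  by apply: sumr_ge0 => k _; rewrite exprn_ge0.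
split; rewrite -lecR; first exact: le_trans (normc_ge_Re _) le1.
rewrite ImE normrN; apply: le_trans (normc_ge_Re _) _.
have norm_i : `|'i%C : C| = 1.
  by rewrite normc_def /= expr0n expr1n add0r sqrtr1.
by rewrite normrM norm_i mulr1.
Qed.

Lemma mulmx_continuous (K : numFieldType) n (A : 'M[K]_n) :
  continuous (fun B : 'M[K]_n => A *m B).
Proof.
(* Matrix neighbourhoods are generated by entrywise ones, so continuity is checked entry by
   entry. *)
move=> B S [P BP PS].
suff : nbhs B [set B' | forall i j, P i j ((A *m B') i j)].
  by apply: filterS => B' /PS.
apply: (@filter_forall _ _
  (fun i B' => forall j, P i j ((A *m B') i j)) (nbhs B) _) => i.
apply: (@filter_forall _ _ (fun j B' => P i j ((A *m B') i j)) (nbhs B) _) => j.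
suff c : continuous (fun B : 'M[K]_n => (A *m B) i j) by exact: c.
under eq_fun do rewrite mxE.
apply: continuous_big => [|k _].
  exact: add_continuous.
move=> M.
apply: (@continuous_comp _ _ _ (fun M : 'M[K]_n => M k j) ( *%R (A i k))).
  exact: coord_continuous.
exact: mulrl_continuous.
Qed.

Lemma unitary_mul_continuous (V : unitary R d) :
  continuous (fun U : unitary R d => (V * U)%g).
Proof.
apply: continuous_comp_initial.
pose m := @unitary_mx R d : unitary R d -> 'M[R[i]^o]_d.
have cm : continuous m := unitary_mx_continuous.
pose mulV (B : 'M[R[i]^o]_d) : 'M[R[i]^o]_d := (V : 'M[R[i]^o]_d) *m B.
have cV : continuous mulV.
  exact: (@mulmx_continuous R[i]).
suff : continuous (mulV \o m) by [].
by move=> U; exact: (continuous_comp (cm U) (cV _)).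
Qed.

Lemma unitary_mul_measurable (V : unitary R d) :
  measurable_fun setT (fun U : UB => (V * (U : unitary R d))%g : UB).
Proof.
have gen : @measurable _ UB = <<s (@open (unitary R d) : set (set UB))>> by [].
apply: (measurability _ gen) => _ [A oA <-].
rewrite setTI; apply: sub_sigma_algebra.
by have /continuousP := unitary_mul_continuous (V := V); apply.
Qed.

Variable mu : probability UB R.
Hypothesis mu_haar : is_haar mu.

(** Change of variables: the pushforward of [mu] under left translation is [mu] itself. *)
Lemma haar_Rintegral (V : unitary R d) (f : UB -> R) M :
  measurable_fun setT f -> (forall U, `|f U| <= M) ->
  Rintegral mu setT (fun U : UB => f (V * (U : unitary R d))%g) =
  Rintegral mu setT f.
Proof.
move=> mf fM; rewrite /Rintegral; congr fine.
pose phi := fun U : UB => (V * (U : unitary R d))%g : UB.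
have mphi : measurable_fun setT phi by exact: unitary_mul_measurable.
have fphi_int : mu.-integrable (phi @^-1` setT) ((EFin \o f) \o phi).
  rewrite preimage_setT.
  apply: (@bounded_integrable _ _ _ _ (f \o phi) M) => [|U].
    exact: measurableT_comp.
  exact: fM.
have mEf : measurable_fun setT (EFin \o f) by exact/measurable_EFinP.
have := integral_pushforward mphi mEf fphi_int measurableT.
rewrite preimage_setT => <-.
apply: eq_measure_integral => A mA _.
(* [is_haar] concerns images of sets, so the preimage of [A] under translation by [V] is read as its
   image under translation by the inverse. *)
apply: etrans (mu_haar V^-1%g mA); congr (mu _).
apply/seteqP; split => U; first by exists (phi U) => //; rewrite mulKg.
by move=> [W AW <-]; rewrite /phi /= mulVKg.
Qed.

Lemma haar_cintegral (V : unitary R d) (h : UB -> C) : bounded_measurable h ->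
  cintegral mu (fun U : UB => h (V * (U : unitary R d))%g) = cintegral mu h.
Proof.
move=> [mR mI [M hM]]; rewrite /cintegral; congr Complex.
  by apply: (@haar_Rintegral V (fun U => Re (h U)) M) => // U; have [] := hM U.
by apply: (@haar_Rintegral V (fun U => Im (h U)) M) => // U; have [] := hM U.
Qed.

Lemma twirl_bounded_measurable n (F : 'M[C]_(tdim d n)) a b :
  bounded_measurable (fun U : UB =>
    (tens_pow n (U : unitary R d) *m F *m
     (tens_pow n (U : unitary R d))^t*) a b).
Proof.
have mt i j :
    bounded_measurable (fun U : UB => tens_pow n (U : unitary R d) i j).
  under eq_fun do rewrite mxE.
  by apply: bounded_measurable_prod => k; exact: entry_bounded_measurable.
under eq_fun do rewrite mxE.
apply: bounded_measurable_sum => k; apply: bounded_measurableM.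
  under eq_fun do rewrite mxE.
  apply: bounded_measurable_sum => l; apply: bounded_measurableM => //.
  exact: bounded_measurable_cst.
under eq_fun do rewrite 2!mxE.
exact: bounded_measurable_conj.
Qed.

(** By linearity the conjugation moves under the integral, where it turns the integrand at [U] into
    the one at [V * U]. *)
Lemma twirl_invariant n (F : 'M[C]_(tdim d n)) (V : unitary R d) :
  let X := mx_integral mu (fun U : UB =>
    tens_pow n (U : unitary R d) *m F *m (tens_pow n (U : unitary R d))^t*) in
  tens_pow n V *m X *m (tens_pow n V)^t* = X.
Proof.
set f := fun U : UB => _; move=> X; pose v := tens_pow n V.
have mf a b : bounded_measurable (fun U => f U a b).
  exact: twirl_bounded_measurable.
have XE a b : X a b = cintegral mu (fun U => f U a b) by rewrite mxE.
have fV U : f (V * (U : unitary R d))%g = v *m f U *m v^t*.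
  by rewrite /f /= tens_pow_mul adjmxM !mulmxA.
apply/matrixP => a b; rewrite [RHS]XE -(haar_cintegral V (mf a b)).
rewrite mxE; under eq_bigr do rewrite mxE mulr_suml.
transitivity (cintegral mu (fun U =>
  \sum_j \sum_i v a i * (v^t*) j b * f U i j)).
  rewrite cintegral_sum => [|j]; last first.
    apply: bounded_measurable_sum => i; apply: bounded_measurableM => //.
    exact: bounded_measurable_cst.
  apply: eq_bigr => j _; rewrite cintegral_sum => [|i]; last first.
    by apply: bounded_measurableM => //; exact: bounded_measurable_cst.
  by apply: eq_bigr => i _; rewrite cintegralZ // -XE mulrAC.
congr cintegral; apply/funext => U; rewrite fV mxE; apply: eq_bigr => j _.
by rewrite [X in _ = X * _]mxE mulr_suml; apply: eq_bigr => i _; rewrite mulrAC.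
Qed.

End Haar.

(** * Operators acting on the unitary factors *)

Section SchurWeyl.
Variables (R : realType) (d n : nat) (SW : schur_weyl R d n).
Local Notation C := R[i].
Local Notation J := (sw_iso SW).
Local Notation Jiso := (sw_iso_isometry SW).
Local Notation Jorth := (@sw_iso_orthogonal _ _ _ SW).
Local Notation Jcompl := (sw_iso_complete SW).

(** Operators acting on the unitary factors alone. This is an injective homomorphism of algebras
    with adjoint whose range contains every [tens_pow n U], so identities there can be read off
    block by block. *)
Definition sw_left (X : forall l, 'M[C]_(sw_m SW l)) : 'M[C]_(tdim d n) :=
  dsum J (fun l => X l *t (1%:M : 'M[C]_(sw_d SW l))).

Lemma sw_m_gt0 l : (0 < sw_m SW l)%N. Proof. by case: (sw_q_irr SW l). Qed.

Lemma sw_d_gt0 l : (0 < sw_d SW l)%N. Proof. by case: (sw_p_irr SW l). Qed.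

Lemma sw_leftM X Y : sw_left X *m sw_left Y = sw_left (fun l => X l *m Y l).
Proof.
rewrite /sw_left (dsumM Jiso Jorth); apply: eq_dsum => l.
by rewrite tensmx_mul mulmx1.
Qed.

Lemma sw_left_adj X : (sw_left X)^t* = sw_left (fun l => (X l)^t*).
Proof.
rewrite /sw_left dsum_adj; apply: eq_dsum => l.
by rewrite adjmx_tens adjmx_scalar rmorph1.
Qed.

Lemma eq_sw_left X Y : (forall l, X l = Y l) -> sw_left X = sw_left Y.
Proof. by move=> XY; apply: eq_dsum => l; rewrite XY. Qed.

Lemma sw_left_inj X Y : sw_left X = sw_left Y -> forall l, X l = Y l.
Proof.
move=> XY l; apply: (tensmx1_inj (sw_d_gt0 l)).
have := congr1 (fun Z => (J l)^t* *m Z *m J l) XY.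
by rewrite !(dsum_block Jiso Jorth).
Qed.

Lemma sw_left1 : sw_left (fun=> 1%:M) = 1%:M.
Proof. by rewrite -(dsum1 Jcompl); apply: eq_dsum => l; rewrite tensmx11. Qed.

Lemma sw_leftB X Y : sw_left X - sw_left Y = sw_left (fun l => X l - Y l).
Proof. by rewrite /sw_left dsumB; apply: eq_dsum => l; rewrite tensmxBl. Qed.

Lemma sw_left_sum (K : finType) (X : K -> forall l, 'M[C]_(sw_m SW l)) :
  \sum_i sw_left (X i) = sw_left (fun l => \sum_i X i l).
Proof.
by rewrite /sw_left dsum_sum; apply: eq_dsum => l; rewrite tensmx_suml.
Qed.

Lemma sw_leftZ a X : a *: sw_left X = sw_left (fun l => a *: X l).
Proof. by rewrite /sw_left dsumZ; apply: eq_dsum => l; rewrite tensmxZl. Qed.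

Lemma sw_left_psd X : (forall l, is_psd (X l)) -> is_psd (sw_left X).
Proof.
by move=> X_psd; apply: dsum_psd => l; apply: psd_tens => //; apply: psd_1.
Qed.

Lemma mxtrace_sw_left X : \tr (sw_left X) = \sum_l \tr (X l) * (sw_d SW l)%:R.
Proof.
rewrite (mxtrace_dsum Jiso); apply: eq_bigr => l _.
by rewrite mxtrace_tens mxtrace1.
Qed.

Lemma tens_pow_sw_left (U : unitary R d) :
  tens_pow n U = sw_left (fun l => sw_q SW l U).
Proof. exact: sw_unitary. Qed.

(** A [schur_weyl] supplies [sw_q] as matrix representations; unitarity is inherited from
    [tens_pow n U]. *)
Lemma sw_q_unitary l (U : unitary R d) :
  (sw_q SW l U)^t* *m sw_q SW l U = 1%:M.
Proof.
have := tens_pow_unitaryV n U; rewrite tens_pow_sw_left sw_left_adj sw_leftM.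
by rewrite -sw_left1 => /sw_left_inj.
Qed.

(** Since [rho] commutes with permutations, its block between [l] and [l'] intertwines [sw_p].
    Off-diagonal blocks vanish by inequivalence, and diagonal ones act on the first factor only. *)
Lemma sw_decomposes_exists (rho : 'M[C]_(tdim d n)) : is_psd rho ->
  (forall s : 'S_n, perm_op R d s *m rho *m (perm_op R d s)^t* = rho) ->
  exists r : forall l, 'M[C]_(sw_m SW l), sw_decomposes rho r.
Proof.
move=> rho_psd rho_inv.
have rhoP s : rho *m perm_op R d s = perm_op R d s *m rho.
  by rewrite -{1}(rho_inv s) -mulmxA perm_op_isometry mulmx1.
have block_comm l l' s :
    ((J l)^t* *m rho *m J l') *m (1%:M *t sw_p SW l' s) =
    (1%:M *t sw_p SW l s) *m ((J l)^t* *m rho *m J l').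
  rewrite -mulmxA -(mul_dsum_iso Jiso Jorth (fun l => 1%:M *t sw_p SW l s)).
  rewrite -(sw_perm SW) -mulmxA (mulmxA rho) rhoP !mulmxA (sw_perm SW).
  by rewrite (mul_adjiso_dsum Jiso Jorth).
have rho_blocks := dsum_of_blocks Jcompl (Y := rho).
have ex_r l := commutant_tens (sw_p_irr SW l) (block_comm l l).
pose r l := projT1 (cid (ex_r l)).
have rE l : (J l)^t* *m rho *m J l = r l *t 1%:M := projT2 (cid (ex_r l)).
exists r; split=> [l|].
  apply: (psd_tens1_inv (sw_d_gt0 l)); rewrite -rE.
  exact: psd_conj.
rewrite [LHS]rho_blocks => [|l l' neq_l].
  by apply: eq_dsum => l; rewrite rE.
apply: (intertwiner_tens_eq0 (sw_p_irr SW l) (sw_p_irr SW l')) => //.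
by move=> /sw_p_neq e; rewrite e eqxx in neq_l.
Qed.

(** * Averages over a design *)

Section Design.
Variables (mu : probability (unitary_borel R d) R) (G : {fset unitary R d}).
Hypothesis mu_haar : is_haar mu.
Hypothesis G_design : is_design mu n G.
Hypothesis G_neq0 : #|` G|%:R != 0 :> C.

(** As a Haar twirl, the average is invariant under every [tens_pow n V], not only for [V] in [G];
    its blocks then commute with the irreducible [sw_q] and are scalars. *)
Lemma design_sw_twirl (X : forall l, 'M[C]_(sw_m SW l)) l :
  (#|` G|%:R)^-1 *:
    \sum_(g : G) sw_q SW l (val g) *m X l *m (sw_q SW l (val g))^t* =
  (\tr (X l) / (sw_m SW l)%:R)%:M.
Proof.
pose t l := (#|` G|%:R)^-1 *:
  \sum_(g : G) sw_q SW l (val g) *m X l *m (sw_q SW l (val g))^t*.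
rewrite -/(t l).
have tE : sw_left t = (#|` G|%:R)^-1 *:
    \sum_(g : G) tens_pow n (val g) *m sw_left X *m (tens_pow n (val g))^t*.
  rewrite -sw_leftZ -sw_left_sum; congr (_ *: _); apply: eq_bigr => g _.
  by rewrite tens_pow_sw_left sw_left_adj !sw_leftM.
have t_inv (V : unitary R d) :
    tens_pow n V *m sw_left t *m (tens_pow n V)^t* = sw_left t.
  by rewrite tE G_design twirl_invariant.
have tq V : t l *m sw_q SW l V = sw_q SW l V *m t l.
  have := t_inv V; rewrite tens_pow_sw_left sw_left_adj !sw_leftM.
  move=> /sw_left_inj/(_ l) /= e.
  by rewrite -{1}e -(mulmxA (sw_q SW l V *m t l)) sw_q_unitary mulmx1.
have [a ta] := schur_scalar (sw_q_irr SW l) tq.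
rewrite ta; congr (_%:M).
have m_neq0 : (sw_m SW l)%:R != 0 :> C by rewrite pnatr_eq0 -lt0n sw_m_gt0.
(* The scalar is found by comparing traces, which conjugation by the unitary [sw_q] preserves. *)
apply: (mulIf m_neq0); rewrite mulfVK // mulr_natr -mxtrace_scalar -ta.
rewrite /t mxtraceZ raddf_sum /= (eq_bigr (fun=> \tr (X l))) => [|g _].
  by rewrite sumr_const -cardfE -[\tr _ *+ _]mulr_natl mulKf.
by rewrite mxtrace_mulC mulmxA sw_q_unitary mul1mx.
Qed.

End Design.
End SchurWeyl.

(** * Optimal success probability and optimal measurement *)

Theorem proposition13 (R : realType) (d n : nat)
    (mu : probability (unitary_borel R d) R) (mu_haar : is_haar mu)
    (SW : schur_weyl R d n)
    (G : {fset unitary R d}) (G_group : group_closed [in G])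
    (G_design : is_design mu n G)
    (rho : 'M[R[i]]_(tdim d n)) (rho_state : is_state rho)
    (rho_inv : forall s : 'S_n,
       perm_op R d s *m rho *m (perm_op R d s)^t* = rho) :
  (exists r : forall l, 'M[R[i]]_(sw_m SW l), sw_decomposes rho r) /\
  (forall r : forall l, 'M[R[i]]_(sw_m SW l), sw_decomposes rho r ->
     p_succ_opt (gu_ensemble (G := G) rho) =
       (#|` G|%:R)^-1 *
       \sum_(l : partition_le d n)
          (sw_d SW l)%:R * (sw_m SW l)%:R * lambda_max (r l) /\
     is_optimal_povm (gu_ensemble (G := G) rho) (opt_povm (G := G) r)).
Proof.
split; first by case: rho_state => rho_psd _; apply: sw_decomposes_exists.
move=> r [r_psd rhoE].
set v := (X in p_succ_opt _ = X).
have G_neq0 : #|` G|%:R != 0 :> R[i].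
  rewrite pnatr_eq0 -lt0n cardfs_gt0; apply/fset0Pn.
  by exists 1%g; case: G_group.
have rho_left : rho = sw_left r by rewrite rhoE.
pose lam l := lambda_max (r l).
pose c l : R[i] := (sw_m SW l)%:R / (#|` G|%:R * (max_dim (r l))%:R).
pose M0 := sw_left (SW := SW) (fun l => c l *: max_proj (r l)).
(* A feasible point of the dual semidefinite program: [K] dominates every state of the ensemble, and
   its trace is the bound. *)
pose K := sw_left (SW := SW) (fun l => (lam l)%:M).
have povmE (g : G) : opt_povm (G := G) r g =
    tens_pow n (val g) *m M0 *m (tens_pow n (val g))^t*.
  rewrite /opt_povm tens_pow_adj; congr (_ *m _ *m _).
  by apply: eq_dsum => l; rewrite tensmxZl.
have trK : \tr K = \sum_l (sw_d SW l)%:R * (sw_m SW l)%:R * lambda_max (r l).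
  rewrite mxtrace_sw_left; apply: eq_bigr => l _.
  by rewrite mxtrace_scalar -[lam l *+ _]mulr_natr mulrC [lam l * _]mulrC mulrA.
have K_ge (g : G) : is_psd (K - gu_ensemble rho g).
  (* Writing [K] as its own conjugate reduces the inequality to the one for [rho], checked on each
     block. *)
  have -> : K = tens_pow n (val g) *m K *m (tens_pow n (val g))^t*.
    have -> : tens_pow n (val g) *m K = K *m tens_pow n (val g).
      rewrite (tens_pow_sw_left SW) !sw_leftM; apply: eq_sw_left => l.
      by rewrite scalar_mxC.
    by rewrite -mulmxA tens_pow_unitary mulmx1.
  rewrite /gu_ensemble -mulmxBl -mulmxBr rho_left sw_leftB.
  rewrite -{1}[tens_pow n (val g)]trmxCK; apply: psd_conj.
  by apply: sw_left_psd => l; case: (lambda_max_spec (sw_m_gt0 SW l) (r_psd l)).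
have dim_neq0 l : (max_dim (r l))%:R != 0 :> R[i].
  by rewrite pnatr_eq0 -lt0n max_dim_gt0 // sw_m_gt0.
have M_povm : is_povm (opt_povm (G := G) r).
  split=> [g|].
    rewrite povmE -{1}[tens_pow n (val g)]trmxCK; apply: psd_conj.
    apply: sw_left_psd => l; apply: psd_scale; last exact: max_proj_psd.
    by rewrite divr_ge0 ?mulr_ge0 ?ler0n.
  rewrite -(sw_left1 SW).
  rewrite (eq_bigr _ (fun g _ => povmE g)).
  have twirl :=
    design_sw_twirl mu_haar G_design G_neq0
      (fun l => c l *: max_proj (r l)).
  transitivity (sw_left (SW := SW) (fun l =>
    \sum_(g : G) sw_q SW l (val g) *m (c l *: max_proj (r l)) *m
      (sw_q SW l (val g))^t*)).
    rewrite -sw_left_sum; apply: eq_bigr => g _.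
    by rewrite (tens_pow_sw_left SW) sw_left_adj !sw_leftM.
  (* Both sides are divided by the order of [G] to expose the design average; the factor [sw_m] in
     [c] cancels the one in the twirl, and [max_dim] cancels the trace of the projector. *)
  apply: eq_sw_left => l; apply: (scalerI (invr_neq0 G_neq0)).
  rewrite twirl mxtraceZ trace_max_proj scalemx1; congr (_%:M).
  have m_neq0 : (sw_m SW l)%:R != 0 :> R[i] by rewrite pnatr_eq0 -lt0n sw_m_gt0.
  by rewrite /c invfM mulrA mulfVK // mulrAC mulfV // mul1r.
have le_v N : is_povm N -> success (gu_ensemble (G := G) rho) N <= v.
  move=> [N_psd N_sum]; rewrite /success /v -cardfE -trK.
  rewrite ler_pM2l ?invr_gt0 ?lt0r ?G_neq0 ?ler0n //.
  (* Replacing the identity by the sum of the [N g] splits the trace of [K] into terms to be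
     compared one by one. *)
  rewrite -[K]mul1mx -N_sum mulmx_suml raddf_sum /=; apply: ler_sum => g _.
  by rewrite -subr_ge0 -raddfB /= -mulmxBr psd_trace_mul.
have M_v : success (gu_ensemble (G := G) rho) (opt_povm (G := G) r) = v.
  rewrite /success /v -cardfE; congr (_ * _).
  (* State and measurement are rotated by the same unitary, so every outcome contributes equally. *)
  transitivity (\sum_(g : G) \tr (M0 *m rho)).
    apply: eq_bigr => g _; rewrite povmE /gu_ensemble -!mulmxA.
    rewrite (mulmxA ((tens_pow n (val g))^t*) (tens_pow n (val g))).
    rewrite tens_pow_unitaryV mul1mx mxtrace_mulC -!mulmxA.
    by rewrite tens_pow_unitaryV mulmx1.
  rewrite sumr_const -cardfE rho_left sw_leftM mxtrace_sw_left.
  rewrite -mulr_natl mulr_sumr.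
  apply: eq_bigr => l _.
  (* On the top eigenspace [r l] acts as its largest eigenvalue, so the upper bound is attained. *)
  rewrite -scalemxAl mxtraceZ mxtrace_mulC mulmx_max_proj mxtraceZ.
  rewrite trace_max_proj.
  rewrite -/(lam l) /c; field.
  by rewrite dim_neq0 G_neq0.
split; last by split=> // N N_povm; rewrite M_v le_v.
apply: maximum_eq; first by exists (opt_povm (G := G) r).
by move=> _ [N N_povm <-]; apply: le_v.
Qed.
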